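(* Let $S$ be a $G^1$ 4-patch surface consisting of $C^2_{\#}$-patches $\mathbf{r}^{(i)}:[0,1]^2\to\mathbb{R}^3$, $i=1,\dots,4$, with common boundary curves $$\mathbf{r}^{(1)}(1,v)=\mathbf{r}^{(2)}(0,v),\quad \mathbf{r}^{(4)}(1,v)=\mathbf{r}^{(3)}(0,v),\quad \mathbf{r}^{(1)}(u,1)=\mathbf{r}^{(4)}(u,0),\quad \mathbf{r}^{(2)}(u,1)=\mathbf{r}^{(3)}(u,0)$$ for all $u,v\in[0,1]$, and let $V=\mathbf{r}^{(1)}(1,1)=\mathbf{r}^{(2)}(0,1)=\mathbf{r}^{(3)}(0,0)=\mathbf{r}^{(4)}(1,0)$ be the intersection point of the four patches. Then $S$ is curvature continuous ($G^2$) if and only if there exist continuously differentiable functions $\lambda_{ij},\kappa_{ij}:[0,1]\to\mathbb{R}$ and continuous functions $\mu_{ij},\nu_{ij}:[0,1]\to\mathbb{R}$, for $(i,j)\in\{(1,2),(1,4),(2,3),(4,3)\}$, such that for all $u,v\in[0,1]$ the first-order relations $$\begin{aligned} \mathbf{r}^{(2)}_u(0,v)&=\lambda_{1,2}(v)\,\mathbf{r}^{(1)}_u(1,v)+\kappa_{1,2}(v)\,\mathbf{r}^{(1)}_v(1,v),\\ \mathbf{r}^{(3)}_u(0,v)&=\lambda_{4,3}(v)\,\mathbf{r}^{(4)}_u(1,v)+\kappa_{4,3}(v)\,\mathbf{r}^{(4)}_v(1,v),\\ \mathbf{r}^{(4)}_v(u,0)&=\lambda_{1,4}(u)\,\mathbf{r}^{(1)}_v(u,1)+\kappa_{1,4}(u)\,\mathbf{r}^{(1)}_u(u,1),\\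 \mathbf{r}^{(3)}_v(u,0)&=\lambda_{2,3}(u)\,\mathbf{r}^{(2)}_v(u,1)+\kappa_{2,3}(u)\,\mathbf{r}^{(2)}_u(u,1) \end{aligned}$$ and the second-order relations $$\begin{aligned} \mathbf{r}^{(2)}_{uu}(0,v)&=\lambda_{1,2}^2(v)\mathbf{r}^{(1)}_{uu}(1,v)+2\lambda_{1,2}(v)\kappa_{1,2}(v)\mathbf{r}^{(1)}_{uv}(1,v)+\kappa_{1,2}^2(v)\mathbf{r}^{(1)}_{vv}(1,v)+\mu_{1,2}(v)\mathbf{r}^{(1)}_u(1,v)+\nu_{1,2}(v)\mathbf{r}^{(1)}_v(1,v),\\ \mathbf{r}^{(3)}_{uu}(0,v)&=\lambda_{4,3}^2(v)\mathbf{r}^{(4)}_{uu}(1,v)+2\lambda_{4,3}(v)\kappa_{4,3}(v)\mathbf{r}^{(4)}_{uv}(1,v)+\kappa_{4,3}^2(v)\mathbf{r}^{(4)}_{vv}(1,v)+\mu_{4,3}(v)\mathbf{r}^{(4)}_u(1,v)+\nu_{4,3}(v)\mathbf{r}^{(4)}_v(1,v),\\ \mathbf{r}^{(3)}_{vv}(u,0)&=\lambda_{2,3}^2(u)\mathbf{r}^{(2)}_{vv}(u,1)+2\lambda_{2,3}(u)\kappa_{2,3}(u)\mathbf{r}^{(2)}_{uv}(u,1)+\kappa_{2,3}^2(u)\mathbf{r}^{(2)}_{uu}(u,1)+\mu_{2,3}(u)\mathbf{r}^{(2)}_v(u,1)+\nu_{2,3}(u)\mathbf{r}^{(2)}_u(u,1),\\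 \mathbf{r}^{(4)}_{vv}(u,0)&=\lambda_{1,4}^2(u)\mathbf{r}^{(1)}_{vv}(u,1)+2\lambda_{1,4}(u)\kappa_{1,4}(u)\mathbf{r}^{(1)}_{uv}(u,1)+\kappa_{1,4}^2(u)\mathbf{r}^{(1)}_{uu}(u,1)+\mu_{1,4}(u)\mathbf{r}^{(1)}_v(u,1)+\nu_{1,4}(u)\mathbf{r}^{(1)}_u(u,1) \end{aligned}$$ hold, and such that the following six relations hold at the vertex $V$: $$\begin{aligned} &2\lambda_{4,3}\lambda'_{1,4}\kappa_{4,3}-\nu_{1,2}+\nu_{4,3}\lambda_{1,4}+\mu_{1,4}\kappa_{4,3}^2=0,\\ &2\lambda_{2,3}\lambda'_{1,2}\kappa_{2,3}-\nu_{1,4}+\nu_{2,3}\lambda_{1,2}+\mu_{1,2}\kappa_{2,3}^2=0,\\ &2\lambda_{4,3}\kappa_{4,3}\kappa'_{1,4}-\mu_{1,2}+\mu_{4,3}+\nu_{4,3}\kappa_{1,4}+\nu_{1,4}\kappa_{4,3}^2=0,\\ &2\lambda_{2,3}\kappa_{2,3}\kappa'_{1,2}-\mu_{1,4}+\mu_{2,3}+\nu_{2,3}\kappa_{1,2}+\nu_{1,2}\kappa_{2,3}^2=0,\\ &\lambda'_{4,3}-\lambda_{2,3}\lambda'_{1,2}+\lambda_{4,3}\kappa'_{1,4}-\lambda_{1,2}\kappa'_{2,3}+\kappa_{1,4}\kappa'_{4,3}-\mu_{1,2}\kappa_{2,3}+\nu_{1,4}\kappa_{4,3}=0,\\ &\lambda'_{2,3}-\lambda_{4,3}\lambda'_{1,4}+\lambda_{2,3}\kappa'_{1,2}-\lambda_{1,4}\kappa'_{4,3}+\kappa_{1,2}\kappa'_{2,3}-\mu_{1,4}\kappa_{4,3}+\nu_{1,2}\kappa_{2,3}=0.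 \end{aligned}$$ Here, in these six relations, functions (and derivatives) with index pair $(1,2)$ or $(1,4)$ are evaluated at the argument $1$, and those with index pair $(2,3)$ or $(4,3)$ at the argument $0$.
   Context: A patch is a map $(u,v)\mapsto\mathbf{r}(u,v)\in\mathbb{R}^3$, $0\le u,v\le1$. It is of class $C^1_{\#}$ if it is continuously differentiable on $[0,1]^2$ and $\mathbf{r}_u\times\mathbf{r}_v\neq0$ for all $0\le u,v\le1$; $C^2_{\#}=C^1_{\#}\cap C^2$. Subscripts $u,v$ denote partial derivatives and a prime denotes the derivative of a function of one variable. A continuous surface is tangent plane continuous ($G^1$) if every point has a unique tangent plane, which varies continuously on the surface; for a surface composed of $C^1_{\#}$-patches this means that at each point of a common boundary curve of two adjacent patches (at the corresponding parameter values) the spans of the first partial derivatives of the two patches coincide. A $G^1$ surface is curvature continuous ($G^2$) if every point has a unique Dupin indicatrix, which varies continuously on the surface; equivalently, the normal curvature at each point in each tangential direction is unique. For a $G^1$ surface composed of $C^2_{\#}$-patches this only has to be checked along the common boundary curves: there, with respect to a common unit normal, the two adjacent patches must have the same normal curvature in every tangential direction. *)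

(* Defs.v *)
From HB Require Import structures.
From mathcomp Require Import all_boot all_order all_algebra.
From mathcomp Require Import all_classical all_reals all_analysis.

Set Implicit Arguments.
Unset Strict Implicit.
Unset Printing Implicit Defensive.

Import Order.TTheory GRing.Theory Num.Theory.
Import numFieldNormedType.Exports.

Local Open Scope classical_set_scope.
Local Open Scope ring_scope.

(* Calculus on the closed interval [0,1] and the closed square [0,1]^2.  Maps
   are total, but derivatives are limits of difference quotients taken inside
   [0,1] (hence one-sided at 0 and 1), so that nothing below depends on values
   outside [0,1] or [0,1]^2. *)
Section Calculus.
Context {R : realType} {V : normedModType R}.

Definition diff_quotient (f : R -> V) (x h : R) : V :=
  h^-1 *: (f (x + h) - f x).

Definition increments01 (x : R) : set_system R :=
  within [set h | 0 <= x + h <= 1] 0^'.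

Definition derivable01 (f : R -> V) (x : R) : Prop :=
  cvg (diff_quotient f x @ increments01 x).

Definition derive01 (f : R -> V) (x : R) : V :=
  lim (diff_quotient f x @ increments01 x).

Definition continuous01 (f : R -> V) : Prop :=
  {within [set x | 0 <= x <= 1], continuous f}.

Definition C1_01 (f : R -> V) : Prop :=
  (forall x, 0 <= x <= 1 -> derivable01 f x) /\ continuous01 (derive01 f).

Definition Du (r : R -> R -> V) (u v : R) : V := derive01 (r ^~ v) u.

Definition Dv (r : R -> R -> V) (u v : R) : V := derive01 (r u) v.

Definition continuous_square (r : R -> R -> V) : Prop :=
  {within [set p : R * R | 0 <= p.1 <= 1 /\ 0 <= p.2 <= 1],
    continuous (fun p => r p.1 p.2)}.

Definition C1_square (r : R -> R -> V) : Prop :=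
  [/\ forall u v, 0 <= u <= 1 -> 0 <= v <= 1 ->
        derivable01 (r ^~ v) u /\ derivable01 (r u) v,
      continuous_square (Du r) & continuous_square (Dv r)].

Definition C2_square (r : R -> R -> V) : Prop :=
  [/\ C1_square r, C1_square (Du r) & C1_square (Dv r)].

(* The subscripts are read from left to right: Duv r is (r_u)_v. *)
Definition Duu (r : R -> R -> V) := Du (Du r).
Definition Duv (r : R -> R -> V) := Dv (Du r).
Definition Dvv (r : R -> R -> V) := Dv (Dv r).

End Calculus.

Section Patches.
Context {R : realType}.

Definition surface_patch := R -> R -> 'rV[R]_3.

Definition dot (a b : 'rV[R]_3) : R := \sum_k a 0 k * b 0 k.

(* Indices are added cyclically in 'I_3. *)
Definition cross (a b : 'rV[R]_3) : 'rV[R]_3 :=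
  \row_(k < 3) (a 0 (k + 1) * b 0 (k + 2) - a 0 (k + 2) * b 0 (k + 1)).

Definition regular_patch (r : surface_patch) : Prop :=
  forall u v, 0 <= u <= 1 -> 0 <= v <= 1 -> cross (Du r u v) (Dv r u v) != 0.

Definition C2_regular (r : surface_patch) : Prop := C2_square r /\ regular_patch r.

(* The arrangement of the patches is
       r4 r3
       r1 r2
   with u growing to the right and v growing upwards. *)
Definition four_patch_surface (r1 r2 r3 r4 : surface_patch) : Prop :=
  forall t, 0 <= t <= 1 ->
    [/\ r1 1 t = r2 0 t, r4 1 t = r3 0 t, r1 t 1 = r4 t 0 & r2 t 1 = r3 t 0].

Definition tangent_plane (r : surface_patch) (u v : R) : {vspace 'rV[R]_3} :=
  (<<[:: Du r u v; Dv r u v]>>)%VS.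

Definition G1_surface (r1 r2 r3 r4 : surface_patch) : Prop :=
  forall t, 0 <= t <= 1 ->
    [/\ tangent_plane r1 1 t = tangent_plane r2 0 t,
        tangent_plane r4 1 t = tangent_plane r3 0 t,
        tangent_plane r1 t 1 = tangent_plane r4 t 0
      & tangent_plane r2 t 1 = tangent_plane r3 t 0].

Definition unit_normal (r : surface_patch) (u v : R) (n : 'rV[R]_3) : Prop :=
  [/\ dot n n = 1, dot n (Du r u v) = 0 & dot n (Dv r u v) = 0].

Definition tangent_vector (r : surface_patch) (u v a b : R) : 'rV[R]_3 :=
  a *: Du r u v + b *: Dv r u v.

Definition first_form (r : surface_patch) (u v a b : R) : R :=
  dot (Du r u v) (Du r u v) * a ^+ 2
  + 2 * dot (Du r u v) (Dv r u v) * a * b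
  + dot (Dv r u v) (Dv r u v) * b ^+ 2.

Definition second_form (r : surface_patch) (n : 'rV[R]_3) (u v a b : R) : R :=
  dot (Duu r u v) n * a ^+ 2
  + 2 * dot (Duv r u v) n * a * b
  + dot (Dvv r u v) n * b ^+ 2.

(* Normal curvature with respect to the unit normal n, in the direction of
   tangent_vector r u v a b. *)
Definition normal_curvature (r : surface_patch) (n : 'rV[R]_3) (u v a b : R) : R :=
  second_form r n u v a b / first_form r u v a b.

(* A tangential direction has different coordinates (a, b) and (c, d) in the
   two patches, so the comparison is made through the common tangent vector. *)
Definition same_normal_curvatures
    (r : surface_patch) (u v : R) (s : surface_patch) (u' v' : R) : Prop :=
  exists n : 'rV[R]_3,
    [/\ unit_normal r u v n, unit_normal s u' v' n
      & forall a b c d : R,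
          tangent_vector r u v a b = tangent_vector s u' v' c d ->
          tangent_vector r u v a b != 0 ->
          normal_curvature r n u v a b = normal_curvature s n u' v' c d].

Definition G2_surface (r1 r2 r3 r4 : surface_patch) : Prop :=
  G1_surface r1 r2 r3 r4 /\
  forall t, 0 <= t <= 1 ->
    [/\ same_normal_curvatures r1 1 t r2 0 t,
        same_normal_curvatures r4 1 t r3 0 t,
        same_normal_curvatures r1 t 1 r4 t 0
      & same_normal_curvatures r2 t 1 r3 t 0].

End Patches.

Arguments surface_patch : clear implicits.

(* Main.v *)
Require Import Defs.
From HB Require Import structures.
From mathcomp Require Import all_boot all_order all_algebra.
From mathcomp Require Import all_classical all_reals all_analysis.
From mathcomp Require Import ring lra.
Import Order.TTheory GRing.Theory Num.Theory.
Import numFieldNormedType.Exports.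
Set Implicit Arguments.
Unset Strict Implicit.
Unset Printing Implicit Defensive.
Local Open Scope classical_set_scope.
Local Open Scope ring_scope.

(** Consider one edge, where the patch r on the side u = 1 meets the patch s on
    the side u = 0. The patches agree there, hence so do their v-derivatives, and
    the common tangent plane gives s_u = l r_u + k r_v; l and k are coordinates in
    the frame (r_u, r_v), given by Cramer's rule, so they are as smooth as the
    frame. Differentiating along the edge expresses s_uv, up to tangent vectors, as
    l r_uv + k r_vv. So the second forms correspond under the change of coordinates
    of tangent vectors as soon as they agree in the single direction s_u across the
    edge, and this means that s_uu - (l^2 r_uu + 2 l k r_uv + k^2 r_vv) is
    orthogonal to the normal, that is, m r_u + n r_v for coefficients given again
    by Cramer's rule. Equality of normal curvatures along an edge is thus
    equivalent to the first- and second-order relations there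
    ([curvature_edge_relations], [edge_relations_curvature]).

    An edge v = const becomes an edge u = const when the two parameters are
    exchanged ([swap_uv]). This replaces r_uv by r_vu, so the symmetry of mixed
    derivatives is needed on the boundary of the closed square, where derivatives
    are one-sided ([mixed_derivatives_eq]).

    Hence the edge relations imply curvature continuity. Conversely, curvature
    continuity gives the edge relations, and these force the six relations at the
    vertex: the second derivatives of the third patch at the vertex can be computed
    through the second patch and through the fourth patch, both starting from the
    first one, and the linear independence of r1_u and r1_v allows the comparison of coefficients
    ([vertex_coefficients]). The second u-derivative gives two relations, the second
    v-derivative gives their images under the exchange of the parameters, and the
    mixed derivative gives the last two. *)

(** * Calculus on the closed interval *)

Section Derivative01.
Context {R : realType}.

#[local] Instance increments01_filter (x : R) : Filter (increments01 x).
Proof. by apply: within_filter. Qed.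

Lemma small_step01 (x e : R) : 0 <= x <= 1 -> 0 < e ->
  exists h, [/\ h != 0, `|h| < e & 0 <= x + h <= 1].
Proof.
move=> x01 e0.
have [h [h0 he h1]] : exists h, [/\ 0 < h, h < e & h <= 2^-1 :> R].
  exists (Num.min (e / 2) 2^-1); split.
  - by rewrite lt_min; apply/andP; split; lra.
  - by rewrite gt_min; apply/orP; left; lra.
  - by rewrite ge_min lexx orbT.
have [xh|xh] := leP x 2^-1.
  by exists h; split; [rewrite gt_eqF|rewrite gtr0_norm|lra].
by exists (- h); split; [rewrite oppr_eq0 gt_eqF|rewrite normrN gtr0_norm|lra].
Qed.

(** Derivatives at the end points are uniquely determined because the one-sided
    increments still accumulate at 0. *)
Lemma increments01_proper (x : R) : 0 <= x <= 1 -> ProperFilter (increments01 x).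
Proof.
move=> x01; split; last exact: increments01_filter.
rewrite /increments01 => /nbhs_ballP[e /= e0 he].
have [h [h0 h1 xh]] := small_step01 x01 e0.
by apply: (he h) => //; rewrite /ball /= sub0r normrN.
Qed.

Lemma increments01_mem (x : R) : \forall h \near increments01 x, 0 <= x + h <= 1.
Proof. exact: withinT. Qed.

Lemma increments01_neq0 (x : R) : \forall h \near increments01 x, h != 0.
Proof. by apply: cvg_within; apply: withinT. Qed.

Lemma increments01_cvg0 (x : R) : h @[h --> increments01 x] --> 0.
Proof.
by apply: cvg_trans; [apply: cvg_within | apply: cvg_within].
Qed.

Definition is_derive01 {V : normedModType R} (f : R -> V) (x : R) (d : V) :=
  diff_quotient f x @ increments01 x --> d.

Section Module.
Context {V : normedModType R}.
Implicit Types (f g : R -> V) (x : R).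

Lemma derive01_val f x d :
  0 <= x <= 1 -> is_derive01 f x d -> derive01 f x = d.
Proof.
move=> x01 fd; have := increments01_proper x01 => ?.
by apply: cvg_lim; [exact: norm_hausdorff|].
Qed.

Lemma derivable01P f x : derivable01 f x -> is_derive01 f x (derive01 f x).
Proof. by []. Qed.

Lemma is_derive01_derivable f x d : is_derive01 f x d -> derivable01 f x.
Proof. by move=> h; apply/cvg_ex; exists d. Qed.

Lemma is_derive01_ext f g x d : 0 <= x <= 1 ->
  (forall t : R, 0 <= t <= 1 -> f t = g t) -> is_derive01 f x d -> is_derive01 g x d.
Proof.
move=> x01 fg; apply: cvg_trans; apply: near_eq_cvg.
near=> h; rewrite /diff_quotient !fg //.
by near: h; apply: increments01_mem.
Unshelve. all: by end_near. Qed.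

(** The limit is taken along the increments rather than in the variable, which
    is the form that the product rule uses. *)
Lemma is_derive01_cvg f x d : is_derive01 f x d ->
  f (x + h) @[h --> increments01 x] --> f x.
Proof.
move=> fd.
have : (f x + h *: diff_quotient f x h) @[h --> increments01 x] --> f x + 0 *: d.
  apply: cvgD; first exact: cvg_cst.
  by apply: cvgZ => //; apply: increments01_cvg0.
rewrite scale0r addr0; apply: cvg_trans; apply: near_eq_cvg.
near=> h; have h0 : h != 0 by near: h; apply: increments01_neq0.
by rewrite /diff_quotient scalerA divff // scale1r addrC subrK.
Unshelve. all: by end_near. Qed.

Lemma is_derive01_continuous f :
  (forall x : R, 0 <= x <= 1 -> derivable01 f x) -> continuous01 f.
Proof.
move=> df; apply/subspace_continuousP => x /= x01.
have /is_derive01_cvg fx := derivable01P (df _ x01).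
apply/cvgrPdist_lt => e e0.
move/cvgrPdist_lt: fx => /(_ e e0) /nbhs_ballP [d /= d0 hd].
apply/nbhs_ballP; exists d => //= y xy /= y01.
have [->|yx] := eqVneq y x; first by rewrite subrr normr0.
have -> : y = x + (y - x) by rewrite addrC subrK.
apply: (hd (y - x)) => /=; rewrite ?subr_eq0 //; last by rewrite addrC subrK.
by move: xy; rewrite /ball /= sub0r normrN distrC.
Qed.

Lemma is_derive01D f g x df dg : is_derive01 f x df -> is_derive01 g x dg ->
  is_derive01 (fun t => f t + g t) x (df + dg).
Proof.
move=> hf hg; apply: cvg_trans (cvgD hf hg); apply: near_eq_cvg.
by near=> h; rewrite /diff_quotient fctE -scalerDr opprD addrACA.
Unshelve. all: by end_near. Qed.

Lemma is_derive01N f x df : is_derive01 f x df ->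
  is_derive01 (fun t => - f t) x (- df).
Proof.
move=> hf; apply: cvg_trans (cvgN hf); apply: near_eq_cvg.
by near=> h; rewrite /diff_quotient fctE -scalerN opprD.
Unshelve. all: by end_near. Qed.

End Module.

Lemma is_derive01Z {V : normedModType R} (s : R -> R) (f : R -> V) x (ds : R) df :
  is_derive01 s x ds -> is_derive01 f x df ->
  is_derive01 (fun t => s t *: f t) x (s x *: df + ds *: f x).
Proof.
move=> hs hf.
have hsf : s (x + h) *: diff_quotient f x h @[h --> increments01 x] --> s x *: df.
  exact: cvgZ (is_derive01_cvg hs) hf.
have hsx : (diff_quotient s x h *: f x) @[h --> increments01 x] --> ds *: f x.
  by apply: cvgZ hs _; apply: cvg_cst.
apply: cvg_trans (cvgD hsf hsx); apply: near_eq_cvg.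
near=> h; rewrite /diff_quotient fctE.
(* s (x + h) f (x + h) - s x f x is split at s (x + h) f x. *)
rewrite scalerA mulrC -scalerA -[(_ *: (s _ - _)) *: _]scalerA -scalerDr.
by congr (_ *: _); rewrite scalerBr scalerBl addrA subrK.
Unshelve. all: by end_near. Qed.

Lemma is_derive01M (s f : R -> R) x (ds df : R) :
  is_derive01 s x ds -> is_derive01 f x df ->
  is_derive01 (fun t => s t * f t) x (s x * df + ds * f x).
Proof. exact: is_derive01Z. Qed.

Lemma is_derive01V (s : R -> R) x (ds : R) : 0 <= x <= 1 ->
  (forall t : R, 0 <= t <= 1 -> s t != 0) -> is_derive01 s x ds ->
  is_derive01 (fun t => (s t)^-1) x (- ((s x)^-1 * (s x)^-1 * ds)).
Proof.
move=> x01 s0 hs.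
have hi : (s (x + h))^-1 * (s x)^-1 @[h --> increments01 x] --> (s x)^-1 * (s x)^-1.
  exact: cvgM (cvgV (s0 _ x01) (is_derive01_cvg hs)) (cvg_cst (s x)^-1).
apply: cvg_trans (cvgN (cvgM hi hs)); apply: near_eq_cvg.
near=> h.
have sh : s (x + h) != 0 by apply: s0; near: h; apply: increments01_mem.
have sx := s0 _ x01.
rewrite /diff_quotient !fctE /GRing.scale /=.
have -> : (s (x + h))^-1 - (s x)^-1
    = - ((s (x + h))^-1 * (s x)^-1 * (s (x + h) - s x)).
  by field; apply/andP.
ring.
Unshelve. all: by end_near. Qed.

Lemma is_derive01_coord n (f : R -> 'rV[R]_n) x d k :
  is_derive01 f x d -> is_derive01 (fun t => f t 0 k) x (d 0 k).
Proof.
move=> hf; have hk : diff_quotient f x h 0 k @[h --> increments01 x] --> d 0 k.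
  by apply: (cvg_comp (diff_quotient f x) (fun M : 'rV[R]_n => M 0 k) hf);
    apply: coord_continuous.
apply: cvg_trans hk; apply: near_eq_cvg.
by near=> h; rewrite /diff_quotient /= !mxE.
Unshelve. all: by end_near. Qed.

Lemma is_derive01_dot (f g : R -> 'rV[R]_3) x df dg :
  is_derive01 f x df -> is_derive01 g x dg ->
  is_derive01 (fun t => dot (f t) (g t)) x (dot (f x) dg + dot df (g x)).
Proof.
move=> hf hg.
have hk k := is_derive01M (is_derive01_coord (k := k) hf) (is_derive01_coord (k := k) hg).
have -> : dot (f x) dg + dot df (g x) =
   \sum_k (f x 0 k * dg 0 k + df 0 k * g x 0 k) by rewrite -big_split.
rewrite !big_ord_recl big_ord0.
have h0 : is_derive01 (fun=> 0 : R) x 0.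
  rewrite /is_derive01 (_ : diff_quotient _ _ = fun=> 0); first exact: cvg_cst.
  by apply/funext => h; rewrite /diff_quotient subrr scaler0.
have := is_derive01D (hk _) (is_derive01D (hk _) (is_derive01D (hk _) h0)).
move=> /(_ ord0 (lift ord0 ord0) (lift ord0 (lift ord0 ord0))).
by congr (is_derive01 _ _ _); apply/funext => t; rewrite /dot !big_ord_recl big_ord0.
Qed.

Section Continuity01.
Context {V : normedModType R}.

Lemma continuous01P (f : R -> V) : continuous01 f <->
  forall x : R, 0 <= x <= 1 -> f @ within [set t | 0 <= t <= 1] (nbhs x) --> f x.
Proof. exact: subspace_continuousP. Qed.

Lemma continuous01_ext (f g : R -> V) :
  (forall t : R, 0 <= t <= 1 -> f t = g t) -> continuous01 f -> continuous01 g.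
Proof. by move=> fg; apply: subspace_eq_continuous => t /set_mem; apply: fg. Qed.

Lemma continuous01D (f g : R -> V) :
  continuous01 f -> continuous01 g -> continuous01 (fun t => f t + g t).
Proof.
move=> /continuous01P hf /continuous01P hg; apply/continuous01P => x x01.
exact: cvgD (hf x x01) (hg x x01).
Qed.

Lemma continuous01N (f : R -> V) :
  continuous01 f -> continuous01 (fun t => - f t).
Proof.
move=> /continuous01P hf; apply/continuous01P => x x01.
exact: cvgN (hf x x01).
Qed.
End Continuity01.

Lemma continuous01Z {V : normedModType R} (s : R -> R) (f : R -> V) :
  continuous01 s -> continuous01 f -> continuous01 (fun t => s t *: f t).
Proof.
move=> /continuous01P hf /continuous01P hg; apply/continuous01P => x x01.
exact: cvgZ (hf x x01) (hg x x01).
Qed.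

Lemma continuous01M (s f : R -> R) :
  continuous01 s -> continuous01 f -> continuous01 (fun t => s t * f t).
Proof. exact: continuous01Z. Qed.

Lemma continuous01V (s : R -> R) : (forall t : R, 0 <= t <= 1 -> s t != 0) ->
  continuous01 s -> continuous01 (fun t => (s t)^-1).
Proof.
move=> s0 /continuous01P hs; apply/continuous01P => x x01.
exact: cvgV (s0 x x01) (hs x x01).
Qed.

Lemma continuous01_coord n (f : R -> 'rV[R]_n) k :
  continuous01 f -> continuous01 (fun t => f t 0 k).
Proof.
move=> /continuous01P hf; apply/continuous01P => x x01.
by apply: (cvg_comp f (fun M : 'rV[R]_n => M 0 k) (hf x x01));
  apply: coord_continuous.
Qed.

Lemma continuous01_dot (f g : R -> 'rV[R]_3) :
  continuous01 f -> continuous01 g -> continuous01 (fun t => dot (f t) (g t)).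
Proof.
move=> hf hg.
have hk k := continuous01M (continuous01_coord (k := k) hf) (continuous01_coord (k := k) hg).
have := continuous01D (hk ord0) (continuous01D (hk (lift ord0 ord0))
  (hk (lift ord0 (lift ord0 ord0)))).
by congr continuous01; apply/funext => t; rewrite /dot !big_ord_recl big_ord0 addr0.
Qed.

Lemma C1_01_continuous {V : normedModType R} (f : R -> V) :
  C1_01 f -> continuous01 f.
Proof. by case=> /is_derive01_continuous. Qed.

Lemma C1_01_derive {V : normedModType R} (f : R -> V) x :
  C1_01 f -> 0 <= x <= 1 -> is_derive01 f x (derive01 f x).
Proof. by case=> fd _ /fd /derivable01P. Qed.

Lemma C1_01_intro {V : normedModType R} (f df : R -> V) :
  (forall x : R, 0 <= x <= 1 -> is_derive01 f x (df x)) -> continuous01 df ->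
  C1_01 f.
Proof.
move=> fd dfc; split=> [x /fd /is_derive01_derivable //|].
by apply: continuous01_ext dfc => t t01; rewrite (derive01_val t01 (fd _ t01)).
Qed.

Lemma C1_01D {V : normedModType R} (f g : R -> V) :
  C1_01 f -> C1_01 g -> C1_01 (fun t => f t + g t).
Proof.
move=> hf hg; apply: C1_01_intro (continuous01D hf.2 hg.2) => x x01.
by apply: is_derive01D; apply: C1_01_derive.
Qed.

Lemma C1_01N {V : normedModType R} (f : R -> V) :
  C1_01 f -> C1_01 (fun t => - f t).
Proof.
move=> hf; apply: C1_01_intro (continuous01N hf.2) => x x01.
by apply: is_derive01N; apply: C1_01_derive.
Qed.

Lemma C1_01M (f g : R -> R) :
  C1_01 f -> C1_01 g -> C1_01 (fun t => f t * g t).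
Proof.
move=> hf hg; have [cf cg] := (C1_01_continuous hf, C1_01_continuous hg).
apply: C1_01_intro (continuous01D (continuous01M cf hg.2) (continuous01M hf.2 cg)).
by move=> x x01; apply: is_derive01M; apply: C1_01_derive.
Qed.

Lemma C1_01V (f : R -> R) : (forall t : R, 0 <= t <= 1 -> f t != 0) ->
  C1_01 f -> C1_01 (fun t => (f t)^-1).
Proof.
move=> f0 hf; have ci := continuous01V f0 (C1_01_continuous hf).
apply: C1_01_intro (continuous01N (continuous01M (continuous01M ci ci) hf.2)).
by move=> x x01; apply: is_derive01V => //; apply: C1_01_derive.
Qed.

Lemma C1_01_dot (f g : R -> 'rV[R]_3) :
  C1_01 f -> C1_01 g -> C1_01 (fun t => dot (f t) (g t)).
Proof.
move=> hf hg; have [cf cg] := (C1_01_continuous hf, C1_01_continuous hg).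
apply: C1_01_intro
  (continuous01D (continuous01_dot cf hg.2) (continuous01_dot hf.2 cg)).
by move=> x x01; apply: is_derive01_dot; apply: C1_01_derive.
Qed.

End Derivative01.

(** * Calculus on the closed square *)

Section Square.
Context {R : realType}.

Lemma continuous_squareP {V : normedModType R} (g : R -> R -> V) :
  continuous_square g <->
  forall u v : R, 0 <= u <= 1 -> 0 <= v <= 1 -> forall e, 0 < e ->
  exists2 d : R, 0 < d & forall x y, 0 <= x <= 1 -> 0 <= y <= 1 ->
    `|u - x| < d -> `|v - y| < d -> `|g u v - g x y| < e.
Proof.
rewrite /continuous_square; split=> [/subspace_continuousP cg u v u01 v01 e e0|cg].
  have /cvgrPdist_lt/(_ _ e0)/nbhs_ballP[d /= d0 hd] := cg (u, v) (conj u01 v01).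
  exists d => // x y x01 y01 ux vy; exact: (hd (x, y)).
apply/subspace_continuousP => -[u v] /= [u01 v01].
apply/cvgrPdist_lt => e e0; have [d d0 hd] := cg u v u01 v01 e e0.
by apply/nbhs_ballP; exists d => //= -[x y] [/= ux vy] [x01 y01]; apply: hd.
Qed.

Lemma continuous01_eps {V : normedModType R} (g : R -> V) :
  (forall u : R, 0 <= u <= 1 -> forall e, 0 < e ->
  exists2 d : R, 0 < d & forall x, 0 <= x <= 1 ->
    `|u - x| < d -> `|g u - g x| < e) -> continuous01 g.
Proof.
move=> cg; apply/continuous01P => u u01.
apply/cvgrPdist_lt => e e0; have [d d0 hd] := cg u u01 e e0.
by apply/nbhs_ballP; exists d => //= x /= ux x01; apply: hd.
Qed.

Lemma continuous_square_l {V : normedModType R} (g : R -> R -> V) (u : R) :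
  0 <= u <= 1 -> continuous_square g -> continuous01 (g u).
Proof.
move=> u01 /continuous_squareP cg; apply: continuous01_eps => v v01 e e0.
have [d d0 hd] := cg u v u01 v01 e e0.
by exists d => // y y01 vy; apply: hd; rewrite ?subrr ?normr0.
Qed.

Lemma continuous_square_swap {V : normedModType R} (g : R -> R -> V) :
  continuous_square g -> continuous_square (fun u v => g v u).
Proof.
move=> /continuous_squareP cg; apply/continuous_squareP => u v u01 v01 e e0.
by have [d d0 hd] := cg v u v01 u01 e e0; exists d => // *; apply: hd.
Qed.

Lemma continuous_square_coord n (g : R -> R -> 'rV[R]_n) k :
  continuous_square g -> continuous_square (fun u v => g u v 0 k).
Proof.
move=> /subspace_continuousP cg; apply/subspace_continuousP => p p01.
by apply: (cvg_comp _ (fun M : 'rV[R]_n => M 0 k) (cg p p01));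
  apply: coord_continuous.
Qed.

Lemma is_derive01_is_derive (f : R -> R) (x d : R) :
  0 < x < 1 -> is_derive01 f x d -> is_derive x (1 : R) f d.
Proof.
move=> /andP[x0 x1] fd.
have hd : h^-1 *: ((f \o shift x) (h *: (1 : R)) - f x) @[h --> 0^'] --> d.
  apply/cvgrPdist_lt => e e0.
  move/cvgrPdist_lt: fd => /(_ e e0) /nbhs_ballP [c /= c0 hc].
  apply/nbhs_ballP; exists (Num.min c (Num.min x (1 - x))).
    by rewrite /= !lt_min c0 x0 subr_gt0.
  move=> h; rewrite /ball /= sub0r normrN !lt_min => /and3P[hc' hx hx1] h0.
  have := hc h; rewrite /ball /= sub0r normrN /diff_quotient.
  rewrite /shift /GRing.scale /= mulr1 [h + x]addrC; apply => //.
  by move: hx hx1; rewrite !ltr_norml => /andP[? ?] /andP[? ?]; lra.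
by split; [apply/cvg_ex; exists d | apply: cvg_lim].
Qed.

Lemma mean_value01 (f df : R -> R) (a b : R) : 0 <= a -> a < b -> b <= 1 ->
  (forall x : R, 0 <= x <= 1 -> is_derive01 f x (df x)) ->
  exists2 c, a <= c <= b & f b - f a = df c * (b - a).
Proof.
move=> a0 ab b1 fd.
have cf : {within `[a, b], continuous f}.
  have cf01 : continuous01 f.
    by apply: is_derive01_continuous => x /fd /is_derive01_derivable.
  apply: continuous_subspaceW cf01 => x /=; rewrite in_itv /= => /andP[? ?].
  by apply/andP; split; lra.
have fab x : x \in `]a, b[%R -> is_derive x (1 : R) f (df x).
  rewrite in_itv /= => /andP[? ?]; apply: is_derive01_is_derive; first by lra.
  by apply: fd; lra.
have [c + fc] := MVT ab fab cf.
by rewrite in_itv /= => /andP[? ?]; exists c => //; lra.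
Qed.

(** Mean value theorem twice: first in u for the difference of the two rows
    v = c and v = d, then in v for the partial derivative that appears. The
    left side is symmetric in the two variables, which is what makes the
    mixed partial derivatives agree. *)
Lemma second_difference (f fu fuv : R -> R -> R) (a b c d : R) :
  0 <= a -> a < b -> b <= 1 -> 0 <= c -> c < d -> d <= 1 ->
  (forall u v : R, 0 <= u <= 1 -> 0 <= v <= 1 ->
    is_derive01 (f ^~ v) u (fu u v) /\ is_derive01 (fu u) v (fuv u v)) ->
  exists x y, [/\ a <= x <= b, c <= y <= d &
    f b d - f b c - (f a d - f a c) = fuv x y * ((b - a) * (d - c))].
Proof.
move=> a0 ab b1 c0 cd d1 hf.
have [c01 d01] : 0 <= c <= 1 /\ 0 <= d <= 1 by split; lra.
have [x xab ex] : exists2 x, a <= x <= b &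
    (f b d - f b c) - (f a d - f a c) = (fu x d - fu x c) * (b - a).
  apply: (@mean_value01 (fun u => f u d - f u c) (fun u => fu u d - fu u c)) => //.
  move=> u u01; apply: is_derive01D; first by have [] := hf u d u01 d01.
  by apply: is_derive01N; have [] := hf u c u01 c01.
have x01 : 0 <= x <= 1 by lra.
have [y ycd ey] := mean_value01 c0 cd d1 (fun v v01 => (hf x v x01 v01).2).
by exists x, y; split=> //; rewrite ex ey; ring.
Qed.

Lemma small_interval01 (x e : R) : 0 <= x <= 1 -> 0 < e ->
  exists a b, [/\ 0 <= a, a < b, b <= 1 & forall t, a <= t <= b -> `|x - t| < e].
Proof.
move=> x01 e0; have [h [h0]] := small_step01 x01 e0.
rewrite ltr_norml => he xh; have [hp|hn] := ltP 0 h.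
  by exists x, (x + h); split=> [|||t tx]; rewrite ?ltr_norml; lra.
have {h0}hn : h < 0 by rewrite lt_def eq_sym h0.
by exists (x + h), x; split=> [|||t tx]; rewrite ?ltr_norml; lra.
Qed.

(** Schwarz's theorem on the closed square. A small rectangle of the square
    with corner (u, v) exists even when (u, v) lies on the boundary; on it the
    second difference equals its area times a value of either mixed derivative,
    so the two are equal at points arbitrarily close to (u, v). *)
Lemma mixed_derivatives_eq (f fu fv fuv fvu : R -> R -> R) (u v : R) :
  (forall u v : R, 0 <= u <= 1 -> 0 <= v <= 1 ->
    is_derive01 (f ^~ v) u (fu u v) /\ is_derive01 (fu u) v (fuv u v)) ->
  (forall u v : R, 0 <= u <= 1 -> 0 <= v <= 1 ->
    is_derive01 (f u) v (fv u v) /\ is_derive01 (fv ^~ v) u (fvu u v)) ->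
  continuous_square fuv -> continuous_square fvu ->
  0 <= u <= 1 -> 0 <= v <= 1 -> fuv u v = fvu u v.
Proof.
move=> hu hv /continuous_squareP cuv /continuous_squareP cvu u01 v01.
(* Were the gap e positive, continuity at tolerance e / 2 would contradict the
   common value taken at two nearby points. *)
apply/eqP; rewrite -subr_eq0 -normr_eq0 -[_ == 0]negbK; apply/negP => gap.
set e := `|_| in gap.
have e0 : 0 < e / 2 by rewrite divr_gt0 // lt_def gap normr_ge0.
have [d1 d10 hd1] := cuv u v u01 v01 _ e0.
have [d2 d20 hd2] := cvu u v u01 v01 _ e0.
have d0 : 0 < Num.min d1 d2 by rewrite lt_min d10.
have [a [b [a0 ab b1 hab]]] := small_interval01 u01 d0.
have [c [d [c0 cd dle1 hcd]]] := small_interval01 v01 d0.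
have [x [y [xab ycd exy]]] := second_difference a0 ab b1 c0 cd dle1 hu.
have [y' [x' [ycd' xab' exy']]] :=
  second_difference (f := fun v u => f u v) (fu := fun v u => fv u v)
    (fuv := fun v u => fvu u v) c0 cd dle1 a0 ab b1
    (fun v u v01 u01 => hv u v u01 v01).
have same : fuv x y = fvu x' y'.
  have q0 : (b - a) * (d - c) != 0 by rewrite mulf_neq0 // subr_eq0 gt_eqF.
  by apply: (mulIf q0); rewrite -exy [(b - a) * _]mulrC -exy'; ring.
have [xd yd xd' yd'] := And4 (hab _ xab) (hcd _ ycd) (hab _ xab') (hcd _ ycd').
move: xd yd xd' yd'; rewrite !lt_min.
move=> /andP[xd _] /andP[yd _] /andP[_ xd'] /andP[_ yd'].
have [x01 y01 x01' y01'] : [/\ 0 <= x <= 1, 0 <= y <= 1, 0 <= x' <= 1 & 0 <= y' <= 1].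
  by split; lra.
have l1 := hd1 x y x01 y01 xd yd; have l2 := hd2 x' y' x01' y01' xd' yd'.
have : e <= `|fuv u v - fuv x y| + `|fvu u v - fvu x' y'|.
  rewrite /e -[`|fvu u v - _|]normrN; apply: le_trans (ler_normD _ _).
  by rewrite same opprB addrA subrK.
by lra.
Qed.

Lemma mixed_partials n (r : R -> R -> 'rV[R]_n) (u v : R) : C2_square r ->
  0 <= u <= 1 -> 0 <= v <= 1 -> Duv r u v = Du (Dv r) u v.
Proof.
move=> [[dr _ _] [ddu _ cuv] [ddv cvu _]] u01 v01; apply/rowP => k.
have hu x y : 0 <= x <= 1 -> 0 <= y <= 1 ->
    is_derive01 (fun t => r t y 0 k) x (Du r x y 0 k) /\
    is_derive01 (fun t => Du r x t 0 k) y (Duv r x y 0 k).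
  move=> x01 y01; have [rx _] := dr x y x01 y01; have [_ ry] := ddu x y x01 y01.
  split; first exact: (is_derive01_coord (k := k) (derivable01P rx)).
  exact: (is_derive01_coord (k := k) (derivable01P ry)).
have hv x y : 0 <= x <= 1 -> 0 <= y <= 1 ->
    is_derive01 (fun t => r x t 0 k) y (Dv r x y 0 k) /\
    is_derive01 (fun t => Dv r t y 0 k) x (Du (Dv r) x y 0 k).
  move=> x01 y01; have [_ ry] := dr x y x01 y01; have [rx _] := ddv x y x01 y01.
  split; first exact: (is_derive01_coord (k := k) (derivable01P ry)).
  exact: (is_derive01_coord (k := k) (derivable01P rx)).
have cuvk := continuous_square_coord (k := k) cuv.
have cvuk := continuous_square_coord (k := k) cvu.
exact: (mixed_derivatives_eq (f := fun u v => r u v 0 k)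
  (fu := fun u v => Du r u v 0 k) (fv := fun u v => Dv r u v 0 k)
  (fuv := fun u v => Duv r u v 0 k) (fvu := fun u v => Du (Dv r) u v 0 k)
  hu hv cuvk cvuk u01 v01).
Qed.

(** Exchanging the parameters turns edges v = const into edges u = const, and
    turns a four-patch surface into another one in which the second and the
    fourth patch have changed places. *)
Definition swap_uv {V : Type} (r : R -> R -> V) : R -> R -> V := fun u v => r v u.

Lemma C1_square_swap {V : normedModType R} (r : R -> R -> V) :
  C1_square r -> C1_square (swap_uv r).
Proof.
move=> [dr cu cv]; split; try exact: continuous_square_swap.
by move=> u v u01 v01; have [] := dr v u v01 u01.
Qed.

Lemma C2_square_swap {V : normedModType R} (r : R -> R -> V) :
  C2_square r -> C2_square (swap_uv r).
Proof. by move=> [r1 ru rv]; split; apply: C1_square_swap. Qed.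

Lemma C1_edge {V : normedModType R} (g : R -> R -> V) (c : R) : 0 <= c <= 1 ->
  C1_square g -> C1_01 (g c).
Proof.
move=> c01 [dg _ cv]; split; last exact: (continuous_square_l c01 cv).
by move=> t t01; have [] := dg c t c01 t01.
Qed.

End Square.

(** * Tangent frames in space *)

Section Space.
Context {R : realType}.
Implicit Types (a b p q w n : 'rV[R]_3).

Let i0 : 'I_3 := ord0.
Let i1 : 'I_3 := lift ord0 ord0.
Let i2 : 'I_3 := lift ord0 (lift ord0 ord0).

Lemma dotE a b : dot a b = a 0 i0 * b 0 i0 + a 0 i1 * b 0 i1 + a 0 i2 * b 0 i2.
Proof. by rewrite /dot !big_ord_recl big_ord0 addr0 addrA. Qed.

Lemma rV3P a b : a 0 i0 = b 0 i0 -> a 0 i1 = b 0 i1 -> a 0 i2 = b 0 i2 -> a = b.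
Proof.
move=> e0 e1 e2; apply/rowP => -[[|[|[|k]]] hk] //.
- by rewrite (_ : Ordinal hk = i0) //; apply: val_inj.
- by rewrite (_ : Ordinal hk = i1) //; apply: val_inj.
- by rewrite (_ : Ordinal hk = i2) //; apply: val_inj.
Qed.

Lemma crossE a b :
  [/\ cross a b 0 i0 = a 0 i1 * b 0 i2 - a 0 i2 * b 0 i1,
      cross a b 0 i1 = a 0 i2 * b 0 i0 - a 0 i0 * b 0 i2
    & cross a b 0 i2 = a 0 i0 * b 0 i1 - a 0 i1 * b 0 i0].
Proof.
have [e01 e02] : i0 + 1 = i1 /\ i0 + 2 = i2 by split; apply: val_inj.
have [e11 e12] : i1 + 1 = i2 /\ i1 + 2 = i0 by split; apply: val_inj.
have [e21 e22] : i2 + 1 = i0 /\ i2 + 2 = i1 by split; apply: val_inj.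
by split; rewrite mxE ?e01 ?e02 ?e11 ?e12 ?e21 ?e22.
Qed.

Lemma dotC a b : dot a b = dot b a.
Proof. by rewrite !dotE; ring. Qed.

Lemma dotDl a b w : dot (a + b) w = dot a w + dot b w.
Proof. by rewrite !dotE !mxE; ring. Qed.

Lemma dotZl x a w : dot (x *: a) w = x * dot a w.
Proof. by rewrite !dotE !mxE; ring. Qed.

Lemma dotNl a w : dot (- a) w = - dot a w.
Proof. by rewrite !dotE !mxE; ring. Qed.

Lemma dotDr a b w : dot w (a + b) = dot w a + dot w b.
Proof. by rewrite !dotE !mxE; ring. Qed.

Lemma dotZr x a w : dot w (x *: a) = x * dot w a.
Proof. by rewrite !dotE !mxE; ring. Qed.

Lemma dot_gt0 a : a != 0 -> 0 < dot a a.
Proof.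
move=> a0; rewrite lt_def dotE -!expr2 !addr_ge0 ?sqr_ge0 // andbT.
apply: contra a0; rewrite !paddr_eq0 ?addr_ge0 ?sqr_ge0 // !sqrf_eq0.
by move=> /andP[/andP[/eqP e0 /eqP e1] /eqP e2]; apply/eqP/rV3P; rewrite mxE.
Qed.

Lemma dot_neq0 a : a != 0 -> dot a a != 0.
Proof. by move/dot_gt0; rewrite lt_def => /andP[]. Qed.

Definition gram p q := dot p p * dot q q - dot p q ^+ 2.

Lemma gramC p q : gram p q = gram q p.
Proof. by rewrite /gram [dot q p]dotC [dot q q * _]mulrC. Qed.

Lemma gram_cross p q : gram p q = dot (cross p q) (cross p q).
Proof.
have [c0 c1 c2] := crossE p q.
by rewrite [RHS]dotE c0 c1 c2 /gram !dotE; ring.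
Qed.

Lemma gram_neq0 p q : cross p q != 0 -> gram p q != 0.
Proof. by rewrite gram_cross; apply: dot_neq0. Qed.

Lemma cross_swap p q : cross q p = - cross p q.
Proof. by apply/rowP => k; rewrite !mxE; ring. Qed.

Lemma dot_crossl p q : dot (cross p q) p = 0.
Proof. by have [c0 c1 c2] := crossE p q; rewrite dotE c0 c1 c2; ring. Qed.

Lemma dot_crossr p q : dot (cross p q) q = 0.
Proof. by have [c0 c1 c2] := crossE p q; rewrite dotE c0 c1 c2; ring. Qed.

(** The coefficient of p in the decomposition of w in the frame (p, q), by
    Cramer's rule for the Gram system. Being an explicit rational expression, it
    inherits the regularity of p, q and w. *)
Definition frame_coord p q w :=
  (dot q q * dot w p - dot p q * dot w q) * (gram p q)^-1.

Lemma frame_coordE p q (x y : R) : gram p q != 0 ->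
  frame_coord p q (x *: p + y *: q) = x.
Proof.
move=> g0; rewrite /frame_coord !dotDl !dotZl [dot q p]dotC.
by move: g0; rewrite /gram => g0; field.
Qed.

(** The expansion of w in the frame formed by p, q and their cross product,
    cleared of denominators. *)
Lemma frame_decomposition p q w :
  gram p q *: w = (dot q q * dot w p - dot p q * dot w q) *: p
    + (dot p p * dot w q - dot p q * dot w p) *: q
    + dot w (cross p q) *: cross p q.
Proof.
have [c0 c1 c2] := crossE p q.
move: (cross p q) c0 c1 c2 => c c0 c1 c2.
by apply: rV3P; rewrite !mxE /gram !dotE ?c0 ?c1 ?c2; ring.
Qed.

(** Since n is orthogonal to the frame it is a multiple of the cross product, so
    a vector orthogonal to n has no component along the cross product. *)
Lemma normal_orthogonal_frame p q n w : cross p q != 0 -> n != 0 ->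
  dot n p = 0 -> dot n q = 0 -> dot w n = 0 ->
  w = frame_coord p q w *: p + frame_coord q p w *: q.
Proof.
move=> c0 n0 np nq wn; have g0 := gram_neq0 c0.
have en := frame_decomposition p q n.
rewrite np nq !mulr0 subrr !scale0r !add0r in en.
have nc0 : dot n (cross p q) != 0.
  apply: contra n0 => /eqP nc; rewrite nc scale0r in en.
  by move/eqP: en; rewrite scaler_eq0 (negbTE g0).
have wc : dot w (cross p q) = 0.
  apply: (mulfI nc0); rewrite -dotZr -en dotZr wn !mulr0 //.
have := frame_decomposition p q w; rewrite wc scale0r addr0 => ew.
apply: (scalerI g0); rewrite {1}ew scalerDr !scalerA /frame_coord.
by rewrite [gram q p]gramC [dot q p]dotC; congr (_ *: _ + _ *: _); field.
Qed.

Lemma frame_inj p q (x y x' y' : R) : cross p q != 0 ->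
  x *: p + y *: q = x' *: p + y' *: q -> x = x' /\ y = y'.
Proof.
move=> c0 e; have g0 := gram_neq0 c0; split.
  by rewrite -(frame_coordE x y g0) e frame_coordE.
rewrite gramC in g0.
by rewrite -(frame_coordE y x g0) addrC e addrC frame_coordE.
Qed.

Lemma unit_normal_exists (r : surface_patch R) (u v : R) :
  cross (Du r u v) (Dv r u v) != 0 -> exists n, unit_normal r u v n.
Proof.
move=> c0; have cc := dot_gt0 c0; set c := cross _ _ in c0 cc.
exists ((Num.sqrt (dot c c))^-1 *: c); split.
- rewrite dotZl dotZr mulrA -invfM -expr2 sqr_sqrtr ?ltW // mulVf //.
  exact: dot_neq0.
- by rewrite dotZl dot_crossl mulr0.
- by rewrite dotZl dot_crossr mulr0.
Qed.

End Space.

Section Frame.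
Context {R : realType}.

Lemma C1_01_frame_coord (p q w : R -> 'rV[R]_3) :
  (forall t : R, 0 <= t <= 1 -> cross (p t) (q t) != 0) ->
  C1_01 p -> C1_01 q -> C1_01 w ->
  C1_01 (fun t => frame_coord (p t) (q t) (w t)).
Proof.
move=> c0 hp hq hw; apply: C1_01M.
  apply: C1_01D; first by apply: C1_01M; apply: C1_01_dot.
  by apply: C1_01N; apply: C1_01M; apply: C1_01_dot.
apply: C1_01V => [t t01|]; first exact: gram_neq0 (c0 t t01).
apply: C1_01D; first by apply: C1_01M; apply: C1_01_dot.
by apply: C1_01N; apply: C1_01M; apply: C1_01_dot.
Qed.

Lemma continuous01_frame_coord (p q w : R -> 'rV[R]_3) :
  (forall t : R, 0 <= t <= 1 -> cross (p t) (q t) != 0) ->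
  continuous01 p -> continuous01 q -> continuous01 w ->
  continuous01 (fun t => frame_coord (p t) (q t) (w t)).
Proof.
move=> c0 hp hq hw; apply: continuous01M.
  apply: continuous01D; first by apply: continuous01M; apply: continuous01_dot.
  by apply: continuous01N; apply: continuous01M; apply: continuous01_dot.
apply: continuous01V => [t t01|]; first exact: gram_neq0 (c0 t t01).
apply: continuous01D; first by apply: continuous01M; apply: continuous01_dot.
by apply: continuous01N; apply: continuous01M; apply: continuous01_dot.
Qed.

Lemma cross_swap_neq0 (p q : 'rV[R]_3) : cross p q != 0 -> cross q p != 0.
Proof. by rewrite cross_swap oppr_eq0. Qed.

Lemma mem_span_frame (p q w : 'rV[R]_3) : cross p q != 0 ->
  w \in <<[:: p; q]>>%VS -> w = frame_coord p q w *: p + frame_coord q p w *: q.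
Proof.
move=> c0; rewrite span_cons span_seq1.
move=> /memv_addP[x /vlineP[a ->]] [y /vlineP[b ->]] ->.
have [g0 g0'] := (gram_neq0 c0, gram_neq0 (cross_swap_neq0 c0)).
by rewrite frame_coordE // addrC frame_coordE // addrC.
Qed.

End Frame.

(** * Curvature continuity across one edge *)

Section Edge.
Context {R : realType}.
Implicit Types (r s : surface_patch R) (l k m n : R -> R).

Lemma in01_0 : 0 <= (0 : R) <= 1. Proof. by rewrite lexx ler01. Qed.
Lemma in01_1 : 0 <= (1 : R) <= 1. Proof. by rewrite lexx ler01. Qed.

Definition edge_tangency r s l k :=
  forall t : R, 0 <= t <= 1 -> Du s 0 t = l t *: Du r 1 t + k t *: Dv r 1 t.

(** The chain rule for the second u-derivative under a change of parameters whose
    first u-derivatives are l, k and whose second ones are m, n. *)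
Definition edge_curvature r s l k m n :=
  forall t : R, 0 <= t <= 1 ->
    Duu s 0 t = l t ^+ 2 *: Duu r 1 t + 2 * l t * k t *: Duv r 1 t
      + k t ^+ 2 *: Dvv r 1 t + m t *: Du r 1 t + n t *: Dv r 1 t.

Definition edge_relations r s l k m n :=
  [/\ C1_01 l, C1_01 k, continuous01 m, continuous01 n
    & edge_tangency r s l k /\ edge_curvature r s l k m n].

Lemma derive01_ext {V : normedModType R} (f g : R -> V) (x : R) : 0 <= x <= 1 ->
  derivable01 f x -> (forall t : R, 0 <= t <= 1 -> f t = g t) ->
  derive01 g x = derive01 f x.
Proof.
by move=> x01 df fg; apply: derive01_val x01 (is_derive01_ext x01 fg (derivable01P df)).
Qed.

Lemma edge_Dv r s : C1_square r -> (forall t : R, 0 <= t <= 1 -> r 1 t = s 0 t) ->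
  forall t : R, 0 <= t <= 1 -> Dv s 0 t = Dv r 1 t.
Proof.
move=> [dr _ _] rs t t01; apply: derive01_ext => //.
by have [] := dr 1 t in01_1 t01.
Qed.

Lemma edge_Dvv r s : C2_square r -> (forall t : R, 0 <= t <= 1 -> r 1 t = s 0 t) ->
  forall t : R, 0 <= t <= 1 -> Dvv s 0 t = Dvv r 1 t.
Proof.
move=> [r1 _ rv] rs; apply: edge_Dv => // t t01.
by rewrite (edge_Dv r1 rs).
Qed.

(** The tangency relation is differentiated along the edge. Thus every entry of
    the second form of s except the one in the direction u, u is determined by
    first-order data and the patch r. *)
Lemma edge_Duv r s l k : C2_square r -> C1_01 l -> C1_01 k ->
  edge_tangency r s l k -> forall t : R, 0 <= t <= 1 ->
  Duv s 0 t = l t *: Duv r 1 t + derive01 l t *: Du r 1 t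
    + (k t *: Dvv r 1 t + derive01 k t *: Dv r 1 t).
Proof.
move=> [_ ru rv] hl hk rs t t01; apply: (derive01_val t01).
apply: (is_derive01_ext t01 (f := fun t => l t *: Du r 1 t + k t *: Dv r 1 t)).
  by move=> x x01; rewrite (rs x x01).
have du := C1_01_derive (C1_edge in01_1 ru) t01.
have dv := C1_01_derive (C1_edge in01_1 rv) t01.
have dl := C1_01_derive hl t01; have dk := C1_01_derive hk t01.
exact: is_derive01D (is_derive01Z dl du) (is_derive01Z dk dv).
Qed.

Lemma dot_combination (p q : 'rV[R]_3) (a b : R) :
  dot (a *: p + b *: q) (a *: p + b *: q)
  = dot p p * a ^+ 2 + 2 * dot p q * a * b + dot q q * b ^+ 2.
Proof. by rewrite !(dotDl, dotDr, dotZl, dotZr) [dot q p]dotC; ring. Qed.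

Lemma dot_combination_eq0 (p q n : 'rV[R]_3) (a b : R) :
  dot n p = 0 -> dot n q = 0 -> dot n (a *: p + b *: q) = 0.
Proof. by move=> np nq; rewrite dotDr !dotZr np nq !mulr0 addr0. Qed.

Lemma first_form_dot r (u v a b : R) :
  first_form r u v a b = dot (tangent_vector r u v a b) (tangent_vector r u v a b).
Proof. exact/esym/dot_combination. Qed.

(** The terms in p and q die against the normal, and the rest is the quadratic
    form with coefficients P, Q, T after the substitution
    (c, d) |-> (l c, k c + d) given by the first-order relation. *)
Lemma second_form_substitution (P Q T p q N : 'rV[R]_3)
    (l k l' k' m n c d : R) : dot N p = 0 -> dot N q = 0 ->
  dot (l ^+ 2 *: P + 2 * l * k *: Q + k ^+ 2 *: T + m *: p + n *: q) N * c ^+ 2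
  + 2 * dot (l *: Q + l' *: p + (k *: T + k' *: q)) N * c * d + dot T N * d ^+ 2
  = dot P N * (l * c) ^+ 2 + 2 * dot Q N * (l * c) * (k * c + d)
    + dot T N * (k * c + d) ^+ 2.
Proof.
by rewrite ![dot N _]dotC => Np Nq; rewrite !(dotDl, dotZl) Np Nq; ring.
Qed.

Lemma edge_second_form r s l k (m n t c d : R) (N : 'rV[R]_3) :
  C2_square r -> (forall t : R, 0 <= t <= 1 -> r 1 t = s 0 t) ->
  C1_01 l -> C1_01 k -> edge_tangency r s l k -> 0 <= t <= 1 ->
  Duu s 0 t = l t ^+ 2 *: Duu r 1 t + 2 * l t * k t *: Duv r 1 t
      + k t ^+ 2 *: Dvv r 1 t + m *: Du r 1 t + n *: Dv r 1 t ->
  unit_normal r 1 t N ->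
  second_form s N 0 t c d = second_form r N 1 t (l t * c) (k t * c + d).
Proof.
move=> hr rs hl hk rst t01 euu [_ Nu Nv].
rewrite /second_form euu (edge_Duv hr hl hk rst t01) (edge_Dvv hr rs t01).
exact: second_form_substitution.
Qed.

Lemma tangent_substitution (p q : 'rV[R]_3) (l k c d : R) :
  c *: (l *: p + k *: q) + d *: q = (l * c) *: p + (k * c + d) *: q.
Proof. by rewrite scalerDr !scalerA scalerDl addrA [c * l]mulrC [c * k]mulrC. Qed.

Lemma edge_tangent_vector r s l k (t c d : R) :
  C1_square r -> (forall t : R, 0 <= t <= 1 -> r 1 t = s 0 t) ->
  edge_tangency r s l k -> 0 <= t <= 1 ->
  tangent_vector s 0 t c d = tangent_vector r 1 t (l t * c) (k t * c + d).
Proof.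
move=> hr rs rst t01; rewrite /tangent_vector (rst t t01) (edge_Dv hr rs t01).
exact: tangent_substitution.
Qed.

Lemma edge_relations_curvature r s l k m n :
  C2_regular r -> (forall t : R, 0 <= t <= 1 -> r 1 t = s 0 t) ->
  edge_relations r s l k m n ->
  forall t : R, 0 <= t <= 1 -> same_normal_curvatures r 1 t s 0 t.
Proof.
move=> [hr reg] rs [hl hk _ _ [rst euu]] t t01.
have r1 : C1_square r by case: hr.
have c0 := reg 1 t in01_1 t01.
have [N hN] := unit_normal_exists c0; have [NN Nu Nv] := hN.
exists N; split; first exact: hN.
  split; first exact: NN.
    by rewrite (rst t t01); apply: dot_combination_eq0.
  by rewrite (edge_Dv r1 rs t01); apply: Nv.
move=> a b c d ers _; rewrite /normal_curvature !first_form_dot ers.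
rewrite (edge_second_form c d hr rs hl hk rst t01 (euu t t01) hN).
rewrite (edge_tangent_vector c d r1 rs rst t01) in ers.
by have [-> ->] := frame_inj c0 ers.
Qed.

Lemma unit_combination (p q : 'rV[R]_3) : p = 1 *: p + 0 *: q.
Proof. by rewrite scale1r scale0r addr0. Qed.

Lemma cross_eq0l (p q : 'rV[R]_3) : p = 0 -> cross p q = 0.
Proof. by move=> ->; apply/rowP => i; rewrite !mxE !mul0r subrr. Qed.

(** The direction (1, 0) across the edge suffices: the curvature equality there
    puts the second-order defect in the tangent plane. *)
Lemma second_form_defect (A B C P Q T N : 'rV[R]_3) (l k : R) :
  dot P N * l ^+ 2 + 2 * dot Q N * l * k + dot T N * k ^+ 2
  = dot A N * 1 ^+ 2 + 2 * dot B N * 1 * 0 + dot C N * 0 ^+ 2 ->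
  dot (A - (l ^+ 2 *: P + 2 * l * k *: Q + k ^+ 2 *: T)) N = 0.
Proof.
rewrite dotDl dotNl !(dotDl, dotZl) => e.
have -> : dot A N = dot A N * 1 ^+ 2 + 2 * dot B N * 1 * 0 + dot C N * 0 ^+ 2.
  by ring.
by rewrite -e; ring.
Qed.

Lemma subr_eq_addr (A X x y : 'rV[R]_3) : A - X = x + y -> A = X + x + y.
Proof. by move=> /eqP; rewrite subr_eq => /eqP ->; rewrite addrC addrA. Qed.

(** The coefficients are the frame coordinates of the cross-boundary derivative,
    which is tangent by assumption, and of the second-order defect, which is
    tangent because its component along the normal vanishes. *)
Lemma curvature_edge_relations r s :
  C2_regular r -> C2_regular s -> (forall t : R, 0 <= t <= 1 -> r 1 t = s 0 t) ->
  (forall t : R, 0 <= t <= 1 -> tangent_plane r 1 t = tangent_plane s 0 t) ->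
  (forall t : R, 0 <= t <= 1 -> same_normal_curvatures r 1 t s 0 t) ->
  exists l k m n, edge_relations r s l k m n.
Proof.
move=> [hr reg] [hs regs] rs tan curv; have [r1 ru rv] := hr; have [s1 su _] := hs.
have c0 t : 0 <= t <= 1 -> cross (Du r 1 t) (Dv r 1 t) != 0 by apply: reg in01_1.
have cu : C1_01 (Du r 1) := C1_edge in01_1 ru.
have cv : C1_01 (Dv r 1) := C1_edge in01_1 rv.
have c0' t : 0 <= t <= 1 -> cross (Dv r 1 t) (Du r 1 t) != 0.
  by move=> t01; apply/cross_swap_neq0/c0.
pose l t := frame_coord (Du r 1 t) (Dv r 1 t) (Du s 0 t).
pose k t := frame_coord (Dv r 1 t) (Du r 1 t) (Du s 0 t).
have csu : C1_01 (Du s 0) := C1_edge in01_0 su.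
have hl : C1_01 l := C1_01_frame_coord c0 cu cv csu.
have hk : C1_01 k := C1_01_frame_coord c0' cv cu csu.
have rst : edge_tangency r s l k.
  move=> t t01; apply: (mem_span_frame (c0 t t01)).
  have /= := tan t t01; rewrite /tangent_plane => ->.
  by rewrite memv_span // mem_head.
(* The defect of the second-order relation before the tangential correction. *)
pose w t := Duu s 0 t - (l t ^+ 2 *: Duu r 1 t + 2 * l t * k t *: Duv r 1 t
                         + k t ^+ 2 *: Dvv r 1 t).
pose m t := frame_coord (Du r 1 t) (Dv r 1 t) (w t).
pose n t := frame_coord (Dv r 1 t) (Du r 1 t) (w t).
have [cl ck] := (C1_01_continuous hl, C1_01_continuous hk).
have [ccu ccv] := (C1_01_continuous cu, C1_01_continuous cv).
have cw : continuous01 w.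
  have [_ cruu cruv] := ru; have [_ _ crvv] := rv; have [_ csuu _] := su.
  apply: continuous01D; first exact: continuous_square_l in01_0 csuu.
  apply: continuous01N; apply: continuous01D; first apply: continuous01D.
  - apply: continuous01Z; first exact: continuous01M.
    exact: continuous_square_l in01_1 cruu.
  - apply: continuous01Z; last exact: continuous_square_l in01_1 cruv.
    apply: continuous01M => //; apply: continuous01M => //.
    by apply/continuous01P => x x01; apply: cvg_cst.
  - apply: continuous01Z; first exact: continuous01M.
    exact: continuous_square_l in01_1 crvv.
have cm : continuous01 m := continuous01_frame_coord c0 ccu ccv cw.
have cn : continuous01 n := continuous01_frame_coord c0' ccv ccu cw.
exists l, k, m, n; split; [exact: hl|exact: hk|exact: cm|exact: cn|].
split; [exact: rst|move=> t t01].
have [N [[NN Nu Nv] [_ _ Nsv] hN]] := curv t t01.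
have N0 : N != 0.
  by apply: contra_eq_neq NN => ->; rewrite dotE !mxE !mul0r !addr0 eq_sym oner_eq0.
have es : tangent_vector r 1 t (l t) (k t) = tangent_vector s 0 t 1 0.
  apply: etrans (esym (rst t t01)) _.
  exact: (unit_combination (Du s 0 t) (Dv s 0 t)).
have s0 : tangent_vector r 1 t (l t) (k t) != 0.
  apply: contra (regs 0 t in01_0 t01) => /eqP e; apply/eqP.
  by apply: cross_eq0l; rewrite (rst t t01); apply: e.
have eII := hN _ _ _ _ es s0.
(* Both first forms are the squared length of the same vector, so the equality
   of normal curvatures becomes one of second forms. *)
have wN : dot (w t) N = 0.
  move: eII; rewrite /normal_curvature !first_form_dot -es.
  move=> /(mulIf (invr_neq0 (dot_neq0 s0))); exact: second_form_defect.
exact: (subr_eq_addr (normal_orthogonal_frame (c0 t t01) N0 Nu Nv wN)).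
Qed.

End Edge.

(** * Compatibility at the vertex *)

Section Vertex.
Context {R : realType}.
Implicit Types r : surface_patch R.

(** The derivatives of the third patch at the vertex are computed by going
    around the vertex through the second and through the fourth patch. Here p, q,
    A, B, C are the first and second derivatives of the first patch, and a letter
    d in front of a coefficient stands for its derivative along the edge. The two
    expressions of the first derivatives force the terms in A, B, C to agree;
    what remains are equations between coordinates in the frame (p, q). *)
Lemma vertex_coefficients (p q A B C r2u r2v r4u r4v r3u r3v
      r2uu r2uv r4uu r4uv r4vv r3uu r3uv : 'rV[R]_3)
    (l12 k12 m12 n12 dl12 dk12 l43 k43 m43 n43 dl43 dk43
     l14 k14 m14 n14 dl14 dk14 l23 k23 dl23 dk23 : R) :
  cross p q != 0 ->
  r2v = q -> r4u = p -> r4uu = A -> r3u = r2u -> r3v = r4v -> r3uu = r2uu ->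
  r2u = l12 *: p + k12 *: q -> r4v = l14 *: q + k14 *: p ->
  r3u = l43 *: r4u + k43 *: r4v -> r3v = l23 *: r2v + k23 *: r2u ->
  r2uu = l12 ^+ 2 *: A + 2 * l12 * k12 *: B + k12 ^+ 2 *: C
    + m12 *: p + n12 *: q ->
  r4vv = l14 ^+ 2 *: C + 2 * l14 * k14 *: B + k14 ^+ 2 *: A
    + m14 *: q + n14 *: p ->
  r3uu = l43 ^+ 2 *: r4uu + 2 * l43 * k43 *: r4uv + k43 ^+ 2 *: r4vv
    + m43 *: r4u + n43 *: r4v ->
  r2uv = l12 *: B + dl12 *: p + (k12 *: C + dk12 *: q) ->
  r4uv = l14 *: B + dl14 *: q + (k14 *: A + dk14 *: p) ->
  r3uv = l43 *: r4uv + dl43 *: r4u + (k43 *: r4vv + dk43 *: r4v) ->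
  r3uv = l23 *: r2uv + dl23 *: r2v + (k23 *: r2uu + dk23 *: r2u) ->
  [/\ 2 * l43 * dl14 * k43 - n12 + n43 * l14 + m14 * k43 ^+ 2 = 0,
      2 * l43 * k43 * dk14 - m12 + m43 + n43 * k14 + n14 * k43 ^+ 2 = 0
    & dl43 - l23 * dl12 + l43 * dk14 - l12 * dk23 + k14 * dk43
      - m12 * k23 + n14 * k43 = 0].
Proof.
move=> c0 -> -> -> -> -> -> e2u e4v e1 e2 e2uu e4vv e3 e2uv e4uv -> e4.
have {e1} [h1 h2] : l12 = l43 + k43 * k14 /\ k12 = k43 * l14.
  apply: (frame_inj c0); rewrite -e2u e1 e4v.
  by apply/rowP => i; rewrite !mxE; ring.
have {e2} [h4 h3] : k14 = k23 * l12 /\ l14 = l23 + k23 * k12.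
  apply: (frame_inj c0); rewrite addrC -e4v e2 e2u.
  by apply/rowP => i; rewrite !mxE; ring.
have [hm hn] : m12 = 2 * l43 * k43 * dk14 + m43 + n43 * k14 + n14 * k43 ^+ 2
    /\ n12 = 2 * l43 * dl14 * k43 + n43 * l14 + m14 * k43 ^+ 2.
  apply: (frame_inj c0); apply/rowP => i.
  move/(congr1 (fun w : 'rV_3 => w 0 i)): e3.
  by rewrite e2uu e4uv e4vv e4v !mxE h1 h2 => e3; lra.
(* The coefficients of A, C and B in the two expressions of r3uv agree. *)
have hA : l43 * k14 + k43 * k14 ^+ 2 = k23 * l12 ^+ 2.
  have -> : k23 * l12 ^+ 2 = (k23 * l12) * l12 by ring.
  by rewrite -h4 h1; ring.
have hC : k43 * l14 ^+ 2 = l23 * k12 + k23 * k12 ^+ 2.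
  have -> : k43 * l14 ^+ 2 = (k43 * l14) * l14 by ring.
  by rewrite -h2 {1}h3; ring.
have hB : l43 * l14 + k43 * (2 * l14 * k14) = l23 * l12 + k23 * (2 * l12 * k12).
  have -> : l43 * l14 + k43 * (2 * l14 * k14)
    = l14 * (l43 + k43 * k14) + (k43 * l14) * k14 by ring.
  by rewrite -h1 -h2 h4 {1}h3; ring.
have [h5 _] : dl43 + l43 * dk14 + k14 * dk43 + n14 * k43
      = l23 * dl12 + l12 * dk23 + m12 * k23
    /\ l43 * dl14 + k43 * m14 + dk43 * l14
      = dl23 + l23 * dk12 + k23 * n12 + dk23 * k12.
  apply: (frame_inj c0); apply/rowP => i.
  have hAi := congr1 (fun x => x * A 0 i) hA.
  have hBi := congr1 (fun x => x * B 0 i) hB.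
  have hCi := congr1 (fun x => x * C 0 i) hC.
  move/(congr1 (fun w : 'rV_3 => w 0 i)): e4.
  by rewrite e2uv e2uu e4uv e4vv e4v e2u !mxE => e4; lra.
by split; lra.
Qed.

Lemma Duv_swap r (u v : R) : C2_square r -> 0 <= u <= 1 -> 0 <= v <= 1 ->
  Duv (swap_uv r) v u = Duv r u v.
Proof. by move=> hr u01 v01; rewrite (mixed_partials hr). Qed.

(** This yields the relations coming from the second u-derivative of the third
    patch, and the p-component of its mixed derivative. The other three follow by
    exchanging the parameters. *)
Lemma vertex_relations r1 r2 r3 r4
    (l12 l14 l23 l43 k12 k14 k23 k43 m12 m14 m23 m43 n12 n14 n23 n43 : R -> R) :
  C2_regular r1 -> C2_square r2 -> C2_square r3 -> C2_square r4 ->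
  four_patch_surface r1 r2 r3 r4 ->
  edge_relations r1 r2 l12 k12 m12 n12 ->
  edge_relations r4 r3 l43 k43 m43 n43 ->
  edge_relations (swap_uv r1) (swap_uv r4) l14 k14 m14 n14 ->
  edge_relations (swap_uv r2) (swap_uv r3) l23 k23 m23 n23 ->
  [/\ 2 * l43 0 * derive01 l14 1 * k43 0 - n12 1 + n43 0 * l14 1
        + m14 1 * k43 0 ^+ 2 = 0,
      2 * l43 0 * k43 0 * derive01 k14 1 - m12 1 + m43 0
        + n43 0 * k14 1 + n14 1 * k43 0 ^+ 2 = 0
    & derive01 l43 0 - l23 0 * derive01 l12 1 + l43 0 * derive01 k14 1
        - l12 1 * derive01 k23 0 + k14 1 * derive01 k43 0
        - m12 1 * k23 0 + n14 1 * k43 0 = 0].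
Proof.
move=> [hr1 reg] hr2 hr3 hr4 bd.
move=> [hl12 hk12 _ _ [t12 c12]] [hl43 hk43 _ _ [t43 c43]].
move=> [hl14 hk14 _ _ [t14 c14]] [hl23 hk23 _ _ [t23 c23]].
have b12 t : 0 <= t <= 1 -> r1 1 t = r2 0 t by case/bd.
have b43 t : 0 <= t <= 1 -> r4 1 t = r3 0 t by case/bd.
have b14 t : 0 <= t <= 1 -> swap_uv r1 1 t = swap_uv r4 0 t by case/bd.
have b23 t : 0 <= t <= 1 -> swap_uv r2 1 t = swap_uv r3 0 t by case/bd.
have [i0 i1] := (@in01_0 R, @in01_1 R).
have [hs1 hs2] := (C2_square_swap hr1, C2_square_swap hr2).
have C1 (r : surface_patch R) : C2_square r -> C1_square r by case.
have [d1 d4 ds1 ds2] := And4 (C1 _ hr1) (C1 _ hr4) (C1 _ hs1) (C1 _ hs2).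
have f1 := t12 1 i1.
have f2 : Dv r2 0 1 = Dv r1 1 1 := edge_Dv d1 b12 i1.
have f3 : Dv r4 1 0 = l14 1 *: Dv r1 1 1 + k14 1 *: Du r1 1 1 := t14 1 i1.
have f4 : Du r4 1 0 = Du r1 1 1 := edge_Dv ds1 b14 i1.
have f5 := t43 0 i0.
have f5' : Du r3 0 0 = Du r2 0 1 := edge_Dv ds2 b23 i0.
have f6 : Dv r3 0 0 = l23 0 *: Dv r2 0 1 + k23 0 *: Du r2 0 1 := t23 0 i0.
have f6' : Dv r3 0 0 = Dv r4 1 0 := edge_Dv d4 b43 i0.
have s1 := c12 1 i1.
have s2 := edge_Duv hr1 hl12 hk12 t12 i1.
have s3 := c14 1 i1.
rewrite (Duv_swap hr1 i1 i1) in s3.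
have s4 := edge_Duv hs1 hl14 hk14 t14 i1.
rewrite (Duv_swap hr1 i1 i1) (Duv_swap hr4 i1 i0) in s4.
have s5 : Duu r4 1 0 = Duu r1 1 1 := edge_Dvv hs1 b14 i1.
have s7 := c43 0 i0.
have s7' : Duu r3 0 0 = Duu r2 0 1 := edge_Dvv hs2 b23 i0.
have s8 := edge_Duv hr4 hl43 hk43 t43 i0.
have s9 := edge_Duv hs2 hl23 hk23 t23 i0.
rewrite (Duv_swap hr2 i0 i1) (Duv_swap hr3 i0 i0) in s9.
have c0 := reg 1 1 i1 i1.
exact: (vertex_coefficients c0 f2 f4 s5 f5' f6' s7' f1 f3 f5 f6
  s1 s3 s7 s2 s4 s8 s9).
Qed.
End Vertex.

(** * Exchanging the parameters *)

Section Swap.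
Context {R : realType}.
Implicit Types r s : surface_patch R.

Lemma C2_regular_swap r : C2_regular r -> C2_regular (swap_uv r).
Proof.
move=> [hr reg]; split; first exact: C2_square_swap.
by move=> u v u01 v01; apply: cross_swap_neq0 (reg v u v01 u01).
Qed.

Lemma span_swap (p q : 'rV[R]_3) : (<<[:: p; q]>> = <<[:: q; p]>>)%VS.
Proof. by rewrite !span_cons !span_nil !addv0 addvC. Qed.

Lemma tangent_plane_swap r (u v : R) :
  tangent_plane (swap_uv r) v u = tangent_plane r u v.
Proof. exact: (span_swap (Dv r u v) (Du r u v)). Qed.

Lemma tangent_vector_swap r (u v a b : R) :
  tangent_vector (swap_uv r) v u a b = tangent_vector r u v b a.
Proof. exact: (addrC (a *: Dv r u v) (b *: Du r u v)). Qed.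

Lemma binary_form_swap (x y z a b : R) :
  x * a ^+ 2 + 2 * y * a * b + z * b ^+ 2
  = z * b ^+ 2 + 2 * y * b * a + x * a ^+ 2.
Proof. by ring. Qed.

Lemma normal_curvature_swap r n (u v a b : R) : C2_square r ->
  0 <= u <= 1 -> 0 <= v <= 1 ->
  normal_curvature (swap_uv r) n v u a b = normal_curvature r n u v b a.
Proof.
move=> hr u01 v01; rewrite /normal_curvature !first_form_dot tangent_vector_swap.
congr (_ / _); rewrite /second_form (Duv_swap hr u01 v01).
exact: (binary_form_swap (dot (Dvv r u v) n) _ (dot (Duu r u v) n)).
Qed.

Lemma same_normal_curvatures_swap r s (u v u' v' : R) :
  C2_square r -> C2_square s -> 0 <= u <= 1 -> 0 <= v <= 1 ->
  0 <= u' <= 1 -> 0 <= v' <= 1 ->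
  same_normal_curvatures r u v s u' v' ->
  same_normal_curvatures (swap_uv r) v u (swap_uv s) v' u'.
Proof.
move=> hr hs u01 v01 u01' v01' [n [[nn nu nv] [_ nu' nv'] hn]].
exists n; split; [exact: And3 nn nv nu|exact: And3 nn nv' nu'|].
move=> a b c d e; rewrite (normal_curvature_swap n a b hr u01 v01).
rewrite (normal_curvature_swap n c d hs u01' v01').
move: e; rewrite (tangent_vector_swap r u v a b) (tangent_vector_swap s u' v' c d).
exact: hn.
Qed.

Lemma edge_relations_iff r s : C2_regular r -> C2_regular s ->
  (forall t : R, 0 <= t <= 1 -> r 1 t = s 0 t) ->
  (forall t : R, 0 <= t <= 1 -> tangent_plane r 1 t = tangent_plane s 0 t) ->
  (forall t : R, 0 <= t <= 1 -> same_normal_curvatures r 1 t s 0 t)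
  <-> exists l k m n, edge_relations r s l k m n.
Proof.
move=> hr hs rs tan; split; first exact: curvature_edge_relations hr hs rs tan.
by move=> [l [k [m [n E]]]]; apply: edge_relations_curvature hr rs E.
Qed.

End Swap.

(** * The four-patch surface *)

Theorem theorem2 (R : realType) (r1 r2 r3 r4 : surface_patch R)
  (C2r1 : C2_regular r1) (C2r2 : C2_regular r2)
  (C2r3 : C2_regular r3) (C2r4 : C2_regular r4)
  (boundary : four_patch_surface r1 r2 r3 r4)
  (G1S : G1_surface r1 r2 r3 r4) :
  G2_surface r1 r2 r3 r4 <->
  exists l12 l14 l23 l43 k12 k14 k23 k43
         m12 m14 m23 m43 n12 n14 n23 n43 : R -> R,
    [/\ [/\ C1_01 l12, C1_01 l14, C1_01 l23 & C1_01 l43],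
        [/\ C1_01 k12, C1_01 k14, C1_01 k23 & C1_01 k43],
        [/\ continuous01 m12, continuous01 m14,
            continuous01 m23 & continuous01 m43]
      & [/\ continuous01 n12, continuous01 n14,
            continuous01 n23 & continuous01 n43]] /\
    [/\ (* first-order relations *)
        forall u v : R, 0 <= u <= 1 -> 0 <= v <= 1 ->
        [/\ Du r2 0 v = l12 v *: Du r1 1 v + k12 v *: Dv r1 1 v,
            Du r3 0 v = l43 v *: Du r4 1 v + k43 v *: Dv r4 1 v,
            Dv r4 u 0 = l14 u *: Dv r1 u 1 + k14 u *: Du r1 u 1
          & Dv r3 u 0 = l23 u *: Dv r2 u 1 + k23 u *: Du r2 u 1],
        (* second-order relations *)
        forall u v : R, 0 <= u <= 1 -> 0 <= v <= 1 ->
        [/\ Duu r2 0 v = l12 v ^+ 2 *: Duu r1 1 v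
              + 2 * l12 v * k12 v *: Duv r1 1 v + k12 v ^+ 2 *: Dvv r1 1 v
              + m12 v *: Du r1 1 v + n12 v *: Dv r1 1 v,
            Duu r3 0 v = l43 v ^+ 2 *: Duu r4 1 v
              + 2 * l43 v * k43 v *: Duv r4 1 v + k43 v ^+ 2 *: Dvv r4 1 v
              + m43 v *: Du r4 1 v + n43 v *: Dv r4 1 v,
            Dvv r3 u 0 = l23 u ^+ 2 *: Dvv r2 u 1
              + 2 * l23 u * k23 u *: Duv r2 u 1 + k23 u ^+ 2 *: Duu r2 u 1
              + m23 u *: Dv r2 u 1 + n23 u *: Du r2 u 1
          & Dvv r4 u 0 = l14 u ^+ 2 *: Dvv r1 u 1
              + 2 * l14 u * k14 u *: Duv r1 u 1 + k14 u ^+ 2 *: Duu r1 u 1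
              + m14 u *: Dv r1 u 1 + n14 u *: Du r1 u 1]
      & (* relations at the vertex V = r1 1 1 = r2 0 1 = r3 0 0 = r4 1 0 *)
        [/\ 2 * l43 0 * derive01 l14 1 * k43 0 - n12 1 + n43 0 * l14 1
              + m14 1 * k43 0 ^+ 2 = 0,
            2 * l23 0 * derive01 l12 1 * k23 0 - n14 1 + n23 0 * l12 1
              + m12 1 * k23 0 ^+ 2 = 0,
            2 * l43 0 * k43 0 * derive01 k14 1 - m12 1 + m43 0
              + n43 0 * k14 1 + n14 1 * k43 0 ^+ 2 = 0
          & 2 * l23 0 * k23 0 * derive01 k12 1 - m14 1 + m23 0
              + n23 0 * k12 1 + n12 1 * k23 0 ^+ 2 = 0]
        /\
        [/\ derive01 l43 0 - l23 0 * derive01 l12 1 + l43 0 * derive01 k14 1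
              - l12 1 * derive01 k23 0 + k14 1 * derive01 k43 0
              - m12 1 * k23 0 + n14 1 * k43 0 = 0
          & derive01 l23 0 - l43 0 * derive01 l14 1 + l23 0 * derive01 k12 1
              - l14 1 * derive01 k43 0 + k12 1 * derive01 k23 0
              - m14 1 * k43 0 + n12 1 * k23 0 = 0]].
Proof.
have [b12 b43 b14 b23] : [/\ (forall t : R, 0 <= t <= 1 -> r1 1 t = r2 0 t),
    (forall t : R, 0 <= t <= 1 -> r4 1 t = r3 0 t),
    (forall t : R, 0 <= t <= 1 -> swap_uv r1 1 t = swap_uv r4 0 t)
  & (forall t : R, 0 <= t <= 1 -> swap_uv r2 1 t = swap_uv r3 0 t)].
  by split=> t /boundary[].
have [t12 t43 t14 t23] : [/\
    (forall t : R, 0 <= t <= 1 -> tangent_plane r1 1 t = tangent_plane r2 0 t),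
    (forall t : R, 0 <= t <= 1 -> tangent_plane r4 1 t = tangent_plane r3 0 t),
    (forall t : R, 0 <= t <= 1 ->
      tangent_plane (swap_uv r1) 1 t = tangent_plane (swap_uv r4) 0 t)
  & (forall t : R, 0 <= t <= 1 ->
      tangent_plane (swap_uv r2) 1 t = tangent_plane (swap_uv r3) 0 t)].
  split=> t /G1S[g12 g43 g14 g23]; [exact: g12|exact: g43| |].
    by rewrite (tangent_plane_swap r1 t 1) (tangent_plane_swap r4 t 0).
  by rewrite (tangent_plane_swap r2 t 1) (tangent_plane_swap r3 t 0).
have [i0 i1] := (@in01_0 R, @in01_1 R).
have [[h1 _] [h2 _] [h3 _] [h4 _]] := And4 C2r1 C2r2 C2r3 C2r4.
have [C2s1 C2s2 C2s3 C2s4] := And4 (C2_regular_swap C2r1) (C2_regular_swap C2r2)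
  (C2_regular_swap C2r3) (C2_regular_swap C2r4).
have [s1 s2 s3 s4] := And4 (C2_square_swap h1) (C2_square_swap h2)
  (C2_square_swap h3) (C2_square_swap h4).
have boundary' : four_patch_surface (swap_uv r1) (swap_uv r4) (swap_uv r3) (swap_uv r2).
  by move=> t /boundary[].
split=> [[_ curv]|].
- have c12 t : 0 <= t <= 1 -> same_normal_curvatures r1 1 t r2 0 t by case/curv.
  have c43 t : 0 <= t <= 1 -> same_normal_curvatures r4 1 t r3 0 t by case/curv.
  have c14 t : 0 <= t <= 1 ->
      same_normal_curvatures (swap_uv r1) 1 t (swap_uv r4) 0 t.
    move=> t01; have [_ _ c _] := curv t t01.
    exact: (same_normal_curvatures_swap h1 h4 t01 i1 t01 i0 c).
  have c23 t : 0 <= t <= 1 ->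
      same_normal_curvatures (swap_uv r2) 1 t (swap_uv r3) 0 t.
    move=> t01; have [_ _ _ c] := curv t t01.
    exact: (same_normal_curvatures_swap h2 h3 t01 i1 t01 i0 c).
  have [l12 [k12 [m12 [n12 E12]]]] := (edge_relations_iff C2r1 C2r2 b12 t12).1 c12.
  have [l43 [k43 [m43 [n43 E43]]]] := (edge_relations_iff C2r4 C2r3 b43 t43).1 c43.
  have [l14 [k14 [m14 [n14 E14]]]] := (edge_relations_iff C2s1 C2s4 b14 t14).1 c14.
  have [l23 [k23 [m23 [n23 E23]]]] := (edge_relations_iff C2s2 C2s3 b23 t23).1 c23.
  have [v1 v3 v5] := vertex_relations C2r1 h2 h3 h4 boundary E12 E43 E14 E23.
  have [v2 v4 v6] := vertex_relations C2s1 s4 s3 s2 boundary' E14 E23 E12 E43.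
  have [[L12 K12 M12 N12 [T12 U12]] [L43 K43 M43 N43 [T43 U43]]] := (E12, E43).
  have [[L14 K14 M14 N14 [T14 U14]] [L23 K23 M23 N23 [T23 U23]]] := (E14, E23).
  exists l12, l14, l23, l43, k12, k14, k23, k43,
    m12, m14, m23, m43, n12, n14, n23, n43.
  split; first by [].
  split; last by [].
  + move=> u v u01 v01; split.
    * exact: T12 v v01.
    * exact: T43 v v01.
    * exact: T14 u u01.
    * exact: T23 u u01.
  + move=> u v u01 v01; split.
    * exact: U12 v v01.
    * exact: U43 v v01.
    * by have := U23 u u01; rewrite (Duv_swap h2 u01 i1).
    * by have := U14 u u01; rewrite (Duv_swap h1 u01 i1).
- move=> [l12 [l14 [l23 [l43 [k12 [k14 [k23 [k43]]]]]]]].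
  move=> [m12 [m14 [m23 [m43 [n12 [n14 [n23 [n43]]]]]]]].
  move=> [[[L12 L14 L23 L43] [K12 K14 K23 K43]
    [M12 M14 M23 M43] [N12 N14 N23 N43]] [T U _]].
  have E12 : edge_relations r1 r2 l12 k12 m12 n12.
    split; [exact: L12|exact: K12|exact: M12|exact: N12|].
    by split=> t t01; [have [] := T 0 t i0 t01|have [] := U 0 t i0 t01].
  have E43 : edge_relations r4 r3 l43 k43 m43 n43.
    split; [exact: L43|exact: K43|exact: M43|exact: N43|].
    by split=> t t01; [have [] := T 0 t i0 t01|have [] := U 0 t i0 t01].
  have E14 : edge_relations (swap_uv r1) (swap_uv r4) l14 k14 m14 n14.
    split; [exact: L14|exact: K14|exact: M14|exact: N14|].
    split=> t t01; first by have [_ _ T14 _] := T t 0 t01 i0; apply: T14.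
    by rewrite (Duv_swap h1 t01 i1); have [_ _ _ U14] := U t 0 t01 i0; apply: U14.
  have E23 : edge_relations (swap_uv r2) (swap_uv r3) l23 k23 m23 n23.
    split; [exact: L23|exact: K23|exact: M23|exact: N23|].
    split=> t t01; first by have [_ _ _ T23] := T t 0 t01 i0; apply: T23.
    by rewrite (Duv_swap h2 t01 i1); have [_ _ U23 _] := U t 0 t01 i0; apply: U23.
  split; [exact: G1S|move=> t t01; split].
  + exact: (edge_relations_curvature C2r1 b12 E12 t01).
  + exact: (edge_relations_curvature C2r4 b43 E43 t01).
  + have c := edge_relations_curvature C2s1 b14 E14 t01.
    exact: (same_normal_curvatures_swap s1 s4 i1 t01 i0 t01 c).
  + have c := edge_relations_curvature C2s2 b23 E23 t01.
    exact: (same_normal_curvatures_swap s2 s3 i1 t01 i0 t01 c).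
Qed.
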